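(* Let $p_0\approx 0.655$ be the unique solution in $(0,\infty)$ of $\zeta(1+p_0)+1=2^{1+p_0}$, and let $p\ge p_0$. Let $$f_{12}(x)=-f_{11}(x)=-f_{22}(x)=\frac{1}{|x|^{p}}\qquad (x\ne0),$$ and $\mathcal{F}=(f_{11},f_{22},f_{12})$. Then the equidistant configuration is the unique minimizer of $E_{\mathcal{F}}$ at any scale, i.e. for every $\rho>0$ and every $N\in 2\mathbb{N}$, $e^{\rho}$ is the unique minimizer of $E_{\mathcal{F}}$ in $\mathcal{A}_N^{\rho}$.
   Context: $\zeta(s)=\sum_{n\ge1}n^{-s}$ (for $s>1$) is Riemann's zeta function. For $\rho>0$ and a positive even integer $N$ (written $N\in 2\mathbb{N}$), let $$\mathcal{A}_N^{\rho}=\{(x_k)_{k\in\mathbb{Z}}\subset\mathbb{R}:\ x_0=0,\ x_k<x_{k+1}\text{ and }x_{k+N}=x_k+\rho^{-1}N\ \text{ for all }k\in\mathbb{Z}\}$$ be the class of $N$-periodic configurations of density $\rho$. The particle $x_k$ is of type $\epsilon_k$, where $\epsilon_k=1$ if $k$ is odd and $\epsilon_k=2$ if $k$ is even. The equidistant configuration is $e^{\rho}:=(k\rho^{-1})_{k\in\mathbb{Z}}\in\mathcal{A}_N^{\rho}$. Given mirror symmetric interaction potentials $f_{11},f_{22},f_{12}$ (i.e. $f_{\alpha\beta}(-x)=f_{\alpha\beta}(x)$), with $f_{21}:=f_{12}$, and $\mathcal{F}=(f_{11},f_{22},f_{12})$, the energy of $X=(x_i)_{i\in\mathbb{Z}}\in\mathcal{A}_N^{\rho}$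 is $$E_{\mathcal{F}}(X)=\frac1N\sum_{n=1}^{N}\ \sum_{k=-\infty,\,k\neq n}^{\infty} f_{\epsilon_n\epsilon_k}(x_k-x_n),$$ where the inner series is understood as the limit $\lim_{K\to\infty}\sum_{0<|k-n|\le K}f_{\epsilon_n\epsilon_k}(x_k-x_n)$ (for $p\le 1$ the series converges only conditionally). *)

(* Defs.v *)
From HB Require Import structures.
From mathcomp Require Import all_boot all_order all_algebra.
From mathcomp Require Import all_classical all_reals all_analysis.
Import Order.TTheory GRing.Theory Num.Theory.
Import numFieldNormedType.Exports.

Set Implicit Arguments.
Unset Strict Implicit.
Unset Printing Implicit Defensive.

Local Open Scope classical_set_scope.
Local Open Scope ring_scope.

(* Only meaningful for s > 1: limn of a divergent series is a junk value. *)
Definition zeta (R : realType) (s : R) : R :=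
  limn (series (fun n : nat => (n.+1%:R `^ s)^-1)).

Inductive species := Species1 | Species2.

Definition species_of (k : int) : species :=
  if odd `|k|%N then Species1 else Species2.

Record potentials (R : realType) :=
  Potentials { f11 : R -> R; f22 : R -> R; f12 : R -> R }.

Definition interaction (R : realType) (F : potentials R) (a b : species) :
    R -> R :=
  match a, b with
  | Species1, Species1 => f11 F
  | Species2, Species2 => f22 F
  | Species1, Species2 | Species2, Species1 => f12 F
  end.

Definition configurations (R : realType) (N : nat) (rho : R) : set (int -> R) :=
  [set x | [/\ x 0 = 0,
               forall k : int, x k < x (k + 1) &
               forall k : int, x (k + N%:Z) = x k + rho^-1 * N%:R]].

Definition equidistant (R : realType) (rho : R) : int -> R :=
  fun k => k%:~R * rho^-1.

Definition pair_energy (R : realType) (F : potentials R) (x : int -> R)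
    (n k : int) : R :=
  interaction F (species_of n) (species_of k) (x k - x n).

(* The indices k with 0 < |k - n| <= K are the n + j and n - j, 1 <= j <= K. *)
Definition partial_site_energy (R : realType) (F : potentials R)
    (x : int -> R) (n : int) (K : nat) : R :=
  \sum_(1 <= j < K.+1)
    (pair_energy F x n (n + j%:Z) + pair_energy F x n (n - j%:Z)).

Definition energy (R : realType) (F : potentials R) (N : nat)
    (x : int -> R) : R :=
  N%:R^-1 * \sum_(1 <= n < N.+1) limn (partial_site_energy F x n%:Z).

(* The values at x = 0 (there 0^-1 = 0) play no role: x k - x n <> 0 for
   k <> n in a strictly increasing configuration. *)
Definition riesz_potentials (R : realType) (p : R) : potentials R :=
  {| f11 := fun x => - (`|x| `^ p)^-1;
     f22 := fun x => - (`|x| `^ p)^-1;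
     f12 := fun x => (`|x| `^ p)^-1 |}.

Definition minimizer (R : realType) (T : Type) (E : T -> R) (A : set T)
    (x : T) : Prop :=
  A x /\ forall y, A y -> E x <= E y.

Definition unique_minimizer (R : realType) (T : Type) (E : T -> R) (A : set T)
    (x : T) : Prop :=
  unique (minimizer E A) x.

(* Main.v *)
Require Import Defs.
From mathcomp Require Import all_boot all_order all_algebra.
From mathcomp Require Import all_classical all_reals all_analysis.
From mathcomp Require Import ring lra zify.
Import Order.TTheory GRing.Theory Num.Theory.
Import numFieldNormedType.Exports.
Local Open Scope classical_set_scope.
Local Open Scope ring_scope.
Set Implicit Arguments.
Unset Strict Implicit.
Unset Printing Implicit Defensive.

(* For gaps s, t and weights l + m = 1, convexity of the power r^(-p) gives
   (s + t)^(-p) <= l^(1+p) s^(-p) + m^(1+p) t^(-p). Let S_j be the sum over one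
   period of the energies (without sign) at index distance j. Taking
   l = (j-1)/j and m = 1/j yields S_j <= l^(1+p) S_(j-1) + j^(-1-p) S_1, with
   equality for the equidistant configuration, which also minimizes every S_j
   by Jensen. So the excess D_j of S_j over its equidistant value is nonnegative
   and satisfies D_j <= D_(j-1) + j^(-1-p) D_1. The energy excess is 2/N times
   the sum of the differences D_(2m-1) - D_(2m); bounding each attractive
   (even) term in this way leaves at least
   (1 - 2^(-1-p) (zeta(1+p) + 1)) D_1, which is nonnegative exactly when
   p >= p0. Uniqueness comes from the strictness of the inequality for S_2. *)

(** * Convexity of the negative power *)

(** Combine [1 + u < expR u] at [u = - p * ln y] with [ln y <= y - 1]. *)
Lemma powRN_bernoulli_lt (R : realType) (p y : R) :
  0 < p -> 0 < y -> y != 1 -> 1 - p * (y - 1) < y `^ (- p).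
Proof.
move=> p0 y0 y1; rewrite /powR gt_eqF//.
have /expR_gt1Dx : - p * ln y != 0.
  by rewrite mulf_neq0 ?ln_eq0// oppr_eq0 gt_eqF.
apply: le_lt_trans; rewrite mulNr lerD2l lerN2 ler_pM2l//.
by rewrite -[in ln y](subrKC 1 y) le_ln1Dx// ltrBDl subrr.
Qed.

Lemma powRN_tangent_lt (R : realType) (p a b : R) :
  0 < p -> 0 < a -> 0 < b -> a != b ->
  b `^ (- p) * (1 - p * (a / b - 1)) < a `^ (- p).
Proof.
move=> p0 a0 b0 ab.
have ab0 : 0 < a / b by rewrite divr_gt0.
rewrite -[in X in _ < X](divfK (lt0r_neq0 b0) a) powRM ?ltW//.
rewrite mulrC ltr_pM2r ?powR_gt0//; apply: powRN_bernoulli_lt => //.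
by apply: contra ab => /eqP/divr1_eq ->.
Qed.

Lemma powRN_tangent_le (R : realType) (p a b : R) :
  0 < p -> 0 < a -> 0 < b ->
  b `^ (- p) * (1 - p * (a / b - 1)) <= a `^ (- p).
Proof.
move=> p0 a0 b0; have [->|ab] := eqVneq a b.
  by rewrite divff ?gt_eqF// subrr mulr0 subr0 mulr1.
by rewrite ltW// powRN_tangent_lt.
Qed.

(** Turns a Jensen term at the rescaled point [s / l] into one at [s]; this is where the exponent
    [1 + p] comes from. *)
Lemma powRN_div (R : realType) (p s l : R) : 0 < s -> 0 < l ->
  l * (s / l) `^ (- p) = l `^ (1 + p) * s `^ (- p).
Proof.
move=> s0 l0; rewrite powRM ?invr_ge0 ?ltW// -powR_inv1 ?ltW// -powRrM.
rewrite mulN1r opprK powRD ?(gt_eqF l0) ?implybT// powRr1 ?ltW//.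
by rewrite -mulrA [s `^ _ * _]mulrC.
Qed.

(* Jensen's inequality for s / l and t / m with the weights l and m. *)
Lemma powRN_add_lt (R : realType) (p s t l m : R) :
  0 < p -> 0 < s -> 0 < t -> 0 < l -> 0 < m -> l + m = 1 ->
  s / l != s + t ->
  (s + t) `^ (- p) < l `^ (1 + p) * s `^ (- p) + m `^ (1 + p) * t `^ (- p).
Proof.
move=> p0 s0 t0 l0 m0 lm ne; have st0 : 0 < s + t by rewrite addr_gt0.
rewrite -!powRN_div//.
(* Both tangents are taken at [s + t], the mean of [s / l] and [t / m], so the linear terms cancel;
   strictness of one of them is enough. *)
have h1 : l * ((s + t) `^ (- p) * (1 - p * (s / l / (s + t) - 1))) <
          l * (s / l) `^ (- p).
  by rewrite ltr_pM2l// powRN_tangent_lt// divr_gt0.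
have h2 : m * ((s + t) `^ (- p) * (1 - p * (t / m / (s + t) - 1))) <=
          m * (t / m) `^ (- p).
  by rewrite ler_pM2l// powRN_tangent_le// divr_gt0.
apply: le_lt_trans (ltr_leD h1 h2); rewrite le_eqVlt; apply/orP; left.
apply/eqP; have -> : m = 1 - l by rewrite -lm addrAC subrr add0r.
have m0' : 0 < 1 - l by rewrite -lm addrAC subrr add0r.
by field; rewrite !gt_eqF.
Qed.

Lemma powRN_add_le (R : realType) (p s t l m : R) :
  0 < p -> 0 < s -> 0 < t -> 0 < l -> 0 < m -> l + m = 1 ->
  (s + t) `^ (- p) <= l `^ (1 + p) * s `^ (- p) + m `^ (1 + p) * t `^ (- p).
Proof.
move=> p0 s0 t0 l0 m0 lm.
have [e|ne] := eqVneq (s / l) (s + t); last exact/ltW/powRN_add_lt.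
have e' : t / m = s + t.
  have -> : m = 1 - l by rewrite -lm addrAC subrr add0r.
  have m0' : 0 < 1 - l by rewrite -lm addrAC subrr add0r.
  apply/(canLR (mulfK (lt0r_neq0 m0'))).
  have sE : s = (s + t) * l by rewrite -e divfK// gt_eqF.
  by rewrite mulrBr mulr1 -sE addrAC subrr add0r.
by rewrite -!powRN_div// e e' -mulrDl lm mul1r.
Qed.

(** * The zeta function and the threshold exponent *)

(** The bound is 1 plus the integral of t^(-1-q) over [1, n+1]. The tangent at [n.+2], evaluated at
    [n.+1], makes the induction telescope. *)
Lemma series_powR_bound (R : realType) (q : R) (n : nat) : 0 < q ->
  series (fun k : nat => (k.+1%:R `^ (1 + q))^-1) n.+1 <=
  1 + q^-1 * (1 - n.+1%:R `^ (- q)).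
Proof.
move=> q0; elim: n => [|n IH].
  by rewrite seriesEnat /= big_nat1 !powR1 subrr mulr0 addr0 invr1.
rewrite seriesSr; apply: (le_trans (lerD IH (lexx _))).
set a : R := n.+1%:R; set b : R := n.+2%:R.
have a0 : 0 < a by rewrite ltr0n.
have b0 : 0 < b by rewrite ltr0n.
have := powRN_tangent_le q0 a0 b0.
rewrite -powRN opprD powRD ?(gt_eqF b0) ?implybT// (powR_inv1 (ltW b0)).
have -> : a / b - 1 = - b^-1.
  by rewrite /b -[n.+2]addn1 natrD -/a; field; rewrite gt_eqF// addr_gt0.
move=> h; rewrite -addrA lerD2l -(ler_pM2l q0) mulrDr !mulVKf ?gt_eqF//.
move: h; move: (b `^ _) b^-1 (a `^ _) => B c C; move=> h.
rewrite -subr_ge0; rewrite -subr_ge0 in h.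
apply: le_trans h _; rewrite le_eqVlt; apply/orP; left.
by apply/eqP; ring.
Qed.

Lemma cvg_series_powR (R : realType) (q : R) : 0 < q ->
  cvgn (series (fun k : nat => (k.+1%:R `^ (1 + q))^-1 : R)).
Proof.
move=> q0; apply: nondecreasing_is_cvgn.
  by apply: nondecreasing_series => n _ _; rewrite invr_ge0 powR_ge0.
exists (1 + q^-1) => _ [n _ <-].
have h : series (fun k : nat => (k.+1%:R `^ (1 + q))^-1) n.+1 <= 1 + q^-1.
  apply: le_trans (series_powR_bound n q0) _.
  by rewrite lerD2l ler_piMr ?invr_ge0 ?ltW// gerBl powR_ge0.
by apply: le_trans h; rewrite seriesSr lerDl invr_ge0 powR_ge0.
Qed.

Lemma zeta_ge_series (R : realType) (q : R) (n : nat) : 0 < q ->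
  series (fun k : nat => (k.+1%:R `^ (1 + q))^-1) n <= zeta (1 + q).
Proof.
move=> q0; apply: nondecreasing_cvgn_le; last exact: cvg_series_powR.
by apply: nondecreasing_series => k _ _; rewrite invr_ge0 powR_ge0.
Qed.

Lemma zeta_le (R : realType) (q c : R) : 0 < q ->
  (forall n, series (fun k : nat => (k.+1%:R `^ (1 + q))^-1) n <= c) ->
  zeta (1 + q) <= c.
Proof.
by move=> q0 h; apply: limr_le; [exact: cvg_series_powR | exact: nearW].
Qed.

Lemma series_powR_nonincreasing (R : realType) (q r : R) (n : nat) : q <= r ->
  series (fun k : nat => (k.+1%:R `^ (1 + r))^-1 : R) n <=
  series (fun k : nat => (k.+1%:R `^ (1 + q))^-1) n.
Proof.
move=> qr; apply: ler_sum => k _; rewrite lef_pV2 ?posrE ?powR_gt0 ?ltr0n//.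
by rewrite ler_powR ?ler1n// lerD2l.
Qed.

Lemma zeta_nonincreasing (R : realType) (q r : R) : 0 < q -> q <= r ->
  zeta (1 + r) <= zeta (1 + q).
Proof.
move=> q0 qr; apply: zeta_le => [|n]; first exact: lt_le_trans qr.
exact: le_trans (series_powR_nonincreasing n qr) (zeta_ge_series n q0).
Qed.

Lemma powR_base_continuous (R : realType) (a : R) : 0 < a ->
  continuous (fun q : R => a `^ (1 + q)).
Proof.
move=> a0 q; have -> : (fun r : R => a `^ (1 + r)) =
    (fun r => expR ((1 + r) * ln a)).
  by apply/funext => r; rewrite /powR gt_eqF.
apply: continuous_comp; last exact: continuous_expR.
apply: cvgM; last exact: cvg_cst.
by apply: cvgD; [exact: cvg_cst|exact: cvg_id].
Qed.

Lemma powRN_exponent_convex (R : realType) (a x y q : R) : 1 <= a ->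
  x < q < y ->
  (a `^ (1 + q))^-1 <= (y - q) / (y - x) * (a `^ (1 + x))^-1 +
                       (q - x) / (y - x) * (a `^ (1 + y))^-1.
Proof.
move=> a1 /andP[xq qy]; have a0 : 0 < a by exact: lt_le_trans a1.
have xy : 0 < y - x by rewrite subr_gt0 (lt_trans xq).
have lxy := lt_trans xq qy.
(* Tangent at [q] of the exponential function of [r]; the weighted average over [x] and [y] cancels
   the slopes. *)
have tangent r : (a `^ (1 + q))^-1 * (1 + (q - r) * ln a) <= (a `^ (1 + r))^-1.
  rewrite -!powRN.
  have -> : - (1 + r) = - (1 + q) + (q - r) by ring.
  rewrite powRD ?(gt_eqF a0) ?implybT// ler_pM2l ?powR_gt0//.
  by rewrite [X in _ <= X]/powR gt_eqF// expR_ge1Dx.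
have h1 : (y - q) / (y - x) * ((a `^ (1 + q))^-1 * (1 + (q - x) * ln a)) <=
    (y - q) / (y - x) * (a `^ (1 + x))^-1.
  by rewrite ler_pM2l ?divr_gt0 ?subr_gt0.
have h2 : (q - x) / (y - x) * ((a `^ (1 + q))^-1 * (1 + (q - y) * ln a)) <=
    (q - x) / (y - x) * (a `^ (1 + y))^-1.
  by rewrite ler_pM2l ?divr_gt0 ?subr_gt0.
apply: le_trans (lerD h1 h2); rewrite le_eqVlt; apply/orP; left; apply/eqP.
by field; rewrite (gt_eqF xy) gt_eqF// powR_gt0.
Qed.

(** Convexity of each term passes to the partial sums and then to their limit. *)
Lemma zeta_convex (R : realType) (x y q : R) : 0 < x -> x < q < y ->
  zeta (1 + q) <= (y - q) / (y - x) * zeta (1 + x) +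
                  (q - x) / (y - x) * zeta (1 + y).
Proof.
move=> x0 /andP[xq qy]; have q0 := lt_trans x0 xq.
have xy : 0 < y - x by rewrite subr_gt0 (lt_trans xq).
have lxy := lt_trans xq qy.
apply: zeta_le => // n.
have h : series (fun k : nat => (k.+1%:R `^ (1 + q))^-1) n <=
  (y - q) / (y - x) * series (fun k : nat => (k.+1%:R `^ (1 + x))^-1) n +
  (q - x) / (y - x) * series (fun k : nat => (k.+1%:R `^ (1 + y))^-1) n.
  rewrite /series /= !big_distrr -big_split /=; apply: ler_sum => k _.
  by apply: powRN_exponent_convex; rewrite ?ler1n// xq.
apply: le_trans h _; apply: lerD; rewrite ler_pM2l ?divr_gt0 ?subr_gt0//;
  apply: zeta_ge_series => //; exact: lt_trans lxy.
Qed.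

(* p0 is the infimum of the q > 0 with zeta (1 + q) + 1 <= 2 `^ (1 + q). At p0
   this inequality follows from the continuity of the partial sums (and fails
   at 0, so p0 > 0); it cannot be strict because zeta, being convex, does not
   jump up to the left of p0. *)
Lemma zeta_threshold (R : realType) :
  exists p0 : R,
    unique (fun q : R => 0 < q /\ zeta (1 + q) + 1 = 2 `^ (1 + q)) p0.
Proof.
pose A : set R := [set q | 0 < q /\ zeta (1 + q) + 1 <= 2 `^ (1 + q)].
(* The integral bound gives zeta(2) <= 2, and 2 + 1 <= 4. *)
have A1 : A 1.
  split=> //; have -> : (2 : R) `^ (1 + 1) = 4.
    by rewrite -[1 + 1]/(2%:R) powR_mulrn// -natrX.
  have : zeta (1 + 1 : R) <= 1 + 1^-1.
    apply: zeta_le => // -[|n].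
      by rewrite seriesEnat /= big_geq// invr1 addr_ge0.
    apply: le_trans (series_powR_bound n ltr01) _.
    by rewrite invr1 mul1r lerD2l gerBl powR_ge0.
  by rewrite invr1; lra.
have lbA : lbound A 0 by move=> q [/ltW].
have hA : has_inf A by split; [exists 1 | exists 0].
pose p0 := inf A.
have p0ge0 : 0 <= p0 by apply: lb_le_inf => //; exists 1.
have part n :
    series (fun k : nat => (k.+1%:R `^ (1 + p0))^-1) n + 1 <= 2 `^ (1 + p0).
  rewrite leNgt; apply/negP => lt_p0.
  pose f (q : R) :=
    series (fun k : nat => (k.+1%:R `^ (1 + q))^-1) n + 1 - 2 `^ (1 + q).
  have cf : continuous f.
    move=> q; apply: cvgB; last exact: powR_base_continuous.
    apply: cvgD; last exact: cvg_cst.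
    rewrite /series /=; apply: cvg_big => [|k _]; first exact: add_continuous.
    apply: cvgV; first by rewrite gt_eqF// powR_gt0 ltr0n.
    by apply: powR_base_continuous; rewrite ltr0n.
  have f0 : 0 < f p0 by rewrite subr_gt0.
  (* Positivity of [f] near [p0] contradicts the existence of elements of [A] arbitrarily close to
     the infimum. *)
  have /nbhs_ballP[e /= e0 be] : \forall q \near p0, 0 < f q.
    by have := cvgr_gt _ (cf p0) 0 f0; exact.
  have [q [q0 qA] qe] := inf_adherent e0 hA.
  have p0q : p0 <= q by apply: ge_inf; [exists 0|split].
  have := be q; rewrite /ball /= distrC ger0_norm ?subr_ge0// ltrBlDl.
  move=> /(_ qe).
  rewrite subr_gt0 ltNge => /negP; apply; apply: le_trans qA.
  by rewrite lerD2r zeta_ge_series.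
have p0gt0 : 0 < p0.
  rewrite lt_neqAle p0ge0 andbT; apply/eqP => p00.
  (* At exponent 0 two terms already give 1 + 1/2 + 1 > 2. *)
  have := part 2%N; rewrite -p00 addr0 seriesEnat /= big_nat_recr//= big_nat1.
  by rewrite !powRr1// invr1; lra.
have zp0 : zeta (1 + p0) + 1 = 2 `^ (1 + p0).
  apply/eqP; rewrite eq_le; apply/andP; split.
    by rewrite -lerBrDr; apply: zeta_le => // n; rewrite lerBrDr.
  rewrite leNgt; apply/negP => lt_p0.
  pose a := p0 / 2.
  have a0 : 0 < a by rewrite divr_gt0.
  have ap0 : a < p0 by rewrite /a; lra.
  (* On ]a, p0[ the chord of zeta majorizes it, so [u] is a continuous upper bound of zeta(1+q) + 1
     - 2^(1+q). It stays negative just left of [p0], which puts some [p0 - d] in [A]. *)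
  pose u (q : R) := (p0 - q) / (p0 - a) * zeta (1 + a) +
    (q - a) / (p0 - a) * zeta (1 + p0) + 1 - 2 `^ (1 + q).
  have cu : continuous u.
    move=> q; apply: cvgB; last exact: powR_base_continuous.
    apply: cvgD; last exact: cvg_cst.
    apply: cvgD; (apply: cvgM; last exact: cvg_cst);
      (apply: cvgM; last exact: cvg_cst).
      by apply: cvgB; [exact: cvg_cst|exact: cvg_id].
    by apply: cvgB; [exact: cvg_id|exact: cvg_cst].
  have u0 : u p0 < 0.
    rewrite /u subrr !mul0r add0r divff ?mul1r ?subr_lt0//.
    by rewrite gt_eqF// subr_gt0.
  have /nbhs_ballP[e /= e0 be] : \forall q \near p0, u q < 0.
    by have := cvgr_lt _ (cu p0) 0 u0; exact.
  pose d := Num.min (e / 2) ((p0 - a) / 2).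
  have d0 : 0 < d by rewrite lt_min !divr_gt0// subr_gt0.
  have de : d < e by rewrite gt_min; apply/orP; left; lra.
  have da : d < p0 - a by rewrite gt_min; apply/orP; right; lra.
  have := be (p0 - d).
  rewrite /ball /= opprB addrC subrK gtr0_norm// => /(_ de).
  rewrite subr_lt0 => uq.
  have : A (p0 - d).
    split; first by rewrite /a in da; lra.
    apply: le_trans (ltW uq); rewrite lerD2r; apply: zeta_convex => //.
    by apply/andP; split; lra.
  by move=> /(ge_inf (ex_intro _ 0 lbA)); rewrite -/p0; lra.
exists p0; split=> // q [q0 zq].
(* The left side is nonincreasing and the right side strictly increasing, so they agree at most
   once. *)
have lt_false (r s : R) : 0 < r -> r < s -> zeta (1 + r) + 1 = 2 `^ (1 + r) ->
    zeta (1 + s) + 1 <> 2 `^ (1 + s).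
  move=> r0 rs zr zs; have := zeta_nonincreasing r0 (ltW rs).
  rewrite -(lerD2r 1) zr zs leNgt => /negP; apply.
  by rewrite /powR (gt_eqF (ltr0n _ 2)) ltr_expR ltr_pM2r ?ln_gt0 ?ltr1n// ltrD2l.
have [lt|lt|//] := ltgtP p0 q.
  by have := lt_false p0 q p0gt0 lt zp0.
by have := lt_false q p0 q0 lt zq.
Qed.

(** * Convergence of alternating series *)

(* With u the partial sums, u - [odd n] a increases, u + [even n] a decreases,
   and they differ by a. *)
Lemma cvg_alternating_series (R : realType) (a : nat -> R) :
  (forall n, 0 <= a n) -> (forall n, a n.+1 <= a n) -> a n @[n --> \oo] --> 0 ->
  cvgn (series (fun n => (-1) ^+ n * a n)).
Proof.
move=> a0 amono acvg; set u := series _.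
pose lo n := u n - (odd n)%:R * a n.
pose hi n := u n + (~~ odd n)%:R * a n.
have loS n : lo n <= lo n.+1.
  rewrite /lo /u seriesSr /= -signr_odd; case: (odd n) => /=.
    by rewrite mul0r expr1; lra.
  by rewrite mul0r expr0; have := amono n; lra.
have hiS n : hi n.+1 <= hi n.
  rewrite /hi /u seriesSr /= -signr_odd; case: (odd n) => /=.
    by rewrite expr1; have := amono n; lra.
  by rewrite expr0; lra.
have hi0 n : hi n <= a 0%N.
  elim: n => [|n IH]; last exact: le_trans IH.
  by rewrite /hi /u seriesEnat /= big_geq// add0r mul1r.
have lohi n : lo n <= hi n.
  by rewrite /lo /hi; have := a0 n; case: (odd n) => /=; lra.
have clo : cvgn lo.
  apply: nondecreasing_is_cvgn; first exact/nondecreasing_seqP.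
  by exists (a 0%N) => _ [n _ <-]; apply: le_trans (hi0 n).
have c0 : (odd n)%:R * a n @[n --> \oo] --> 0.
  apply/cvgr0Pnorm_lt => e e0; apply: filterS (cvgr0_norm_lt _ acvg _ e0) => n.
  case: (odd n); rewrite ?mul1r// mul0r normr0.
  by move=> _.
have -> : u = (fun n => lo n + (odd n)%:R * a n).
  by apply/funext => n; rewrite /lo subrK.
by apply: is_cvgD => //; apply/cvg_ex; exists 0.
Qed.

(** * Sums over a period and periodic configurations *)

(** A unit shift only trades the first term for its periodic copy at the end. Negative shifts reduce
    to natural ones applied to a translate of [f]. *)
Lemma sum_period_shift (V : zmodType) (N : nat) (f : int -> V) (j : int) :
  (forall k, f (k + N%:Z) = f k) ->
  \sum_(1 <= n < N.+1) f (n%:Z + j) = \sum_(1 <= n < N.+1) f n%:Z.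
Proof.
have shift1 (g : int -> V) : (forall k, g (k + N%:Z) = g k) ->
    \sum_(1 <= n < N.+1) g (n%:Z + 1) = \sum_(1 <= n < N.+1) g n%:Z.
  move=> gN; case: N gN => [|N] gN; first by rewrite !big_geq.
  rewrite big_nat_recr//= [RHS]big_nat_recl//= [RHS]addrC.
  congr (_ + _); last by rewrite addrC gN.
  by apply: eq_bigr => i _; congr g; lia.
have shiftn (m : nat) (g : int -> V) : (forall k, g (k + N%:Z) = g k) ->
    \sum_(1 <= n < N.+1) g (n%:Z + m%:Z) = \sum_(1 <= n < N.+1) g n%:Z.
  move=> gN; elim: m => [|m IH]; first by apply: eq_bigr => i _; rewrite addr0.
  rewrite -IH -(shift1 (fun k => g (k + m%:Z))).
    by apply: eq_bigr => i _; congr g; lia.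
  by move=> k; rewrite addrAC gN.
move=> fN; case: j => m; first exact: shiftn.
rewrite -(shiftn m.+1 (fun k => f (k + Negz m))).
  by apply: eq_bigr => i _; congr f; lia.
by move=> k; rewrite addrAC fN.
Qed.

(** The S_j of the overview. *)
Definition pair_sum (R : realType) (p : R) (N : nat) (x : int -> R)
    (j : nat) : R :=
  \sum_(1 <= n < N.+1) (x (n%:Z + j%:Z) - x n%:Z) `^ (- p).

Lemma configurations_lt (R : realType) (N : nat) (rho : R) (x : int -> R)
    (n : int) (j : nat) :
  configurations N rho x -> (0 < j)%N -> x n < x (n + j%:Z).
Proof.
move=> [_ xS _]; case: j => // j _; elim: j => [|j IH]; first exact: xS.
by apply: lt_trans IH _; have := xS (n + j.+1%:Z); congr (_ < x _); lia.
Qed.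

Lemma configurations_distN (R : realType) (N : nat) (rho : R) (x : int -> R)
    (n j : int) :
  configurations N rho x -> x (n + N%:Z + j) - x (n + N%:Z) = x (n + j) - x n.
Proof. by move=> [_ _ xN]; rewrite addrAC !xN; ring. Qed.

Lemma configurations_addMn (R : realType) (N : nat) (rho : R) (x : int -> R)
    (n : int) (k : nat) :
  configurations N rho x -> x (n + (k * N)%:Z) = x n + k%:R * (rho^-1 * N%:R).
Proof.
move=> [_ _ xN]; elim: k => [|k IH]; first by rewrite mul0n addr0 mul0r addr0.
have -> : n + (k.+1 * N)%:Z = n + (k * N)%:Z + N%:Z by lia.
by rewrite xN IH -natr1; ring.
Qed.

Lemma equidistant_configurations (R : realType) (N : nat) (rho : R) :
  0 < rho -> configurations N rho (equidistant rho).
Proof.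
move=> rho0; split; rewrite /equidistant ?mul0r// => k.
  by rewrite ltr_pM2r ?invr_gt0// ltr_int ltzD1.
by rewrite intrD -pmulrn; ring.
Qed.

Lemma pair_sum_equidistant (R : realType) (p : R) (N : nat) (rho : R)
    (j : nat) :
  pair_sum p N (equidistant rho) j = N%:R * (j%:R * rho^-1) `^ (- p).
Proof.
rewrite /pair_sum /equidistant.
under eq_bigr do rewrite intrD mulrDl addrAC subrr add0r.
by rewrite sumr_const_nat subn1 mulr_natl.
Qed.

(** The deviation [y] from the equidistant configuration is periodic, so its increments cancel over
    a period. *)
Lemma sum_dist (R : realType) (N : nat) (rho : R) (x : int -> R) (j : nat) :
  configurations N rho x ->
  \sum_(1 <= n < N.+1) (x (n%:Z + j%:Z) - x n%:Z) = N%:R * (j%:R * rho^-1).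
Proof.
move=> [_ _ xN]; pose y k := x k - k%:~R * rho^-1.
have yN k : y (k + N%:Z) = y k by rewrite /y xN intrD -pmulrn; ring.
have := sum_period_shift j%:Z yN; move/eqP; rewrite -subr_eq0 -sumrB => /eqP ys.
transitivity (\sum_(1 <= n < N.+1) ((y (n%:Z + j%:Z) - y n%:Z) + j%:R * rho^-1)).
  by apply: eq_bigr => i _; rewrite /y intrD -[j%:~R]pmulrn; ring.
by rewrite big_split /= ys add0r sumr_const_nat subn1 [RHS]mulr_natl.
Qed.

(** * Minimality and recursion of the pair sums *)

(** Jensen by the tangent at the mean distance [c]: the sum of the linear terms is fixed by
    [sum_dist]. *)
Lemma pair_sum_min (R : realType) (p : R) (N : nat) (rho : R) (x : int -> R)
    (j : nat) :
  0 < p -> 0 < rho -> configurations N rho x -> (0 < j)%N ->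
  pair_sum p N (equidistant rho) j <= pair_sum p N x j.
Proof.
move=> p0 rho0 cx j0; set c := j%:R * rho^-1.
have c0 : 0 < c by rewrite mulr_gt0 ?invr_gt0 ?ltr0n.
have h n : c `^ (- p) * (1 + p) - c `^ (- p) * p / c * (x (n + j%:Z) - x n) <=
    (x (n + j%:Z) - x n) `^ (- p).
  apply: le_trans (powRN_tangent_le p0 _ c0); last first.
    by rewrite subr_gt0 (configurations_lt _ cx).
  by rewrite le_eqVlt; apply/orP; left; apply/eqP; ring.
rewrite pair_sum_equidistant -/c.
apply: le_trans (ler_sum _ (fun n _ => h n%:Z)).
rewrite sumrB sumr_const_nat subn1 -mulr_sumr (sum_dist _ cx) -/c.
rewrite -mulr_natl le_eqVlt; apply/orP; left; apply/eqP.
by field; rewrite gt_eqF.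
Qed.

Lemma sum_last_step (R : realType) (p : R) (N : nat) (rho : R) (x : int -> R)
    (j : nat) :
  configurations N rho x ->
  \sum_(1 <= n < N.+1) (x (n%:Z + j.+1%:Z) - x (n%:Z + j%:Z)) `^ (- p) =
  pair_sum p N x 1.
Proof.
move=> cx; rewrite /pair_sum.
rewrite -(@sum_period_shift _ N (fun k => (x (k + 1) - x k) `^ (- p)) j%:Z).
  by apply: eq_bigr => i _; congr ((x _ - _) `^ _); lia.
by move=> k; rewrite (configurations_distN _ _ cx).
Qed.

Lemma weights_sum (R : realType) (j : nat) : j.+1%:R / j.+2%:R + j.+2%:R^-1 = 1 :> R.
Proof. by rewrite -[X in _ + X]mul1r -mulrDl natr1 divff. Qed.

(** Each distance is cut into its first [j.+1] gaps and its last one. Weights proportional to the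
    numbers of gaps make equal gaps the equality case. *)
Lemma pair_sumS_le (R : realType) (p : R) (N : nat) (rho : R) (x : int -> R)
    (j : nat) :
  0 < p -> configurations N rho x ->
  pair_sum p N x j.+2 <=
  (j.+1%:R / j.+2%:R) `^ (1 + p) * pair_sum p N x j.+1 +
  (j.+2%:R `^ (1 + p))^-1 * pair_sum p N x 1.
Proof.
move=> p0 cx; rewrite -(sum_last_step p j.+1 cx) /pair_sum !mulr_sumr -big_split.
apply: ler_sum => n _ /=.
have <- : j.+2%:R^-1 `^ (1 + p) = (j.+2%:R `^ (1 + p))^-1.
  by rewrite -powR_inv1// -powRrM mulN1r powRN.
have -> : x (n%:Z + j.+2%:Z) - x n%:Z =
   (x (n%:Z + j.+1%:Z) - x n%:Z) + (x (n%:Z + j.+2%:Z) - x (n%:Z + j.+1%:Z)).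
  by ring.
apply: powRN_add_le => //.
- by rewrite subr_gt0 (configurations_lt _ cx).
- rewrite subr_gt0; have -> : n%:Z + j.+2%:Z = n%:Z + j.+1%:Z + 1%:Z by lia.
  exact: (configurations_lt _ cx).
- exact: weights_sum.
Qed.

Lemma pair_sumS_equidistant (R : realType) (p : R) (N : nat) (rho : R)
    (j : nat) :
  0 < rho ->
  pair_sum p N (equidistant rho) j.+2 =
  (j.+1%:R / j.+2%:R) `^ (1 + p) * pair_sum p N (equidistant rho) j.+1 +
  (j.+2%:R `^ (1 + p))^-1 * pair_sum p N (equidistant rho) 1.
Proof.
move=> rho0; have r0 : 0 < rho^-1 by rewrite invr_gt0.
rewrite !pair_sum_equidistant mul1r.
have <- : j.+2%:R^-1 `^ (1 + p) = (j.+2%:R `^ (1 + p))^-1.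
  by rewrite -powR_inv1// -powRrM mulN1r powRN.
rewrite [X in _ = X + _]mulrCA [X in _ = _ + X]mulrCA -!powRN_div
  ?mulr_gt0 ?invr_gt0 ?ltr0n//.
have -> : j.+1%:R * rho^-1 / (j.+1%:R / j.+2%:R) = j.+2%:R * rho^-1.
  by field; rewrite !gt_eqF// addr_gt0.
(* Both rescaled distances are now [j.+2%:R * rho^-1], so only the sum of the weights remains. *)
by rewrite invrK [rho^-1 * _]mulrC -mulrDr -mulrDl weights_sum mul1r.
Qed.

(* The case j = 0 of pair_sumS_le: both weights are 1/2, and Jensen's inequality
   is strict as soon as two consecutive gaps differ. *)
Lemma pair_sum2_lt (R : realType) (p : R) (N : nat) (rho : R) (x : int -> R) :
  0 < p -> configurations N rho x ->
  (exists2 n : nat, (1 <= n < N.+1)%N &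
     x (n%:Z + 1) - x n%:Z != x (n%:Z + 2) - x (n%:Z + 1)) ->
  pair_sum p N x 2 < 2 * (2 `^ (1 + p))^-1 * pair_sum p N x 1.
Proof.
move=> p0 cx [n nN ne].
have -> : 2 * (2 `^ (1 + p))^-1 * pair_sum p N x 1 =
    (2^-1) `^ (1 + p) * pair_sum p N x 1 + (2^-1) `^ (1 + p) * pair_sum p N x 1.
  rewrite -mulrA mulr_natl mulr2n -[in RHS]powR_inv1// -powRrM mulN1r powRN.
  by ring.
rewrite -[X in _ + _ * X](sum_last_step p 1 cx) /pair_sum !mulr_sumr -big_split /=.
have step m : x (m + 2) - x m = (x (m + 1) - x m) + (x (m + 2) - x (m + 1)).
  by ring.
have s0 m : 0 < x (m + 1) - x m.
  by rewrite subr_gt0 (@configurations_lt _ _ _ _ m 1 cx).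
have t0 m : 0 < x (m + 2) - x (m + 1).
  have -> : m + 2 = m + 1 + 1 :> int by ring.
  exact: s0.
have half : 2^-1 + 2^-1 = 1 :> R by lra.
(* The index with unequal gaps is isolated: strict inequality there, weak inequality elsewhere. *)
rewrite !(bigD1_seq n) ?mem_index_iota ?iota_uniq//=.
apply: ltr_leD; last first.
  by apply: ler_sum => m _; rewrite step powRN_add_le// invr_gt0.
rewrite step; apply: powRN_add_lt; rewrite ?invr_gt0//.
(* With [l = 1/2], the condition [s / l != s + t] says that the two gaps differ. *)
by apply: contra ne => /eqP h; apply/eqP; move: h; rewrite invrK; lra.
Qed.

Lemma pair_sum2_le (R : realType) (p : R) (N : nat) (rho : R) (x : int -> R) :
  0 < p -> configurations N rho x ->
  pair_sum p N x 2 <= 2 * (2 `^ (1 + p))^-1 * pair_sum p N x 1.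
Proof.
move=> p0 cx; apply: le_trans (pair_sumS_le 0 p0 cx) _.
rewrite div1r -powR_inv1// -powRrM mulN1r powRN -mulrDl.
by rewrite mulr_natl mulr2n.
Qed.

Lemma pair_sum2_equidistant (R : realType) (p : R) (N : nat) (rho : R) :
  0 < rho ->
  pair_sum p N (equidistant rho) 2 =
  2 * (2 `^ (1 + p))^-1 * pair_sum p N (equidistant rho) 1.
Proof.
move=> rho0; rewrite (pair_sumS_equidistant p N 0 rho0).
rewrite div1r -powR_inv1// -powRrM mulN1r powRN -mulrDl.
by rewrite mulr_natl mulr2n.
Qed.

(** * Excess over the equidistant configuration *)

(** The D_j of the overview. *)
Definition excess (R : realType) (p : R) (N : nat) (rho : R) (x : int -> R)
    (j : nat) : R :=
  pair_sum p N x j - pair_sum p N (equidistant rho) j.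

Lemma excess_ge0 (R : realType) (p : R) (N : nat) (rho : R)
    (x : int -> R) (j : nat) :
  0 < p -> 0 < rho -> configurations N rho x -> 0 <= excess p N rho x j.+1.
Proof. by move=> p0 r0 cx; rewrite subr_ge0 pair_sum_min. Qed.

Lemma excessS_le (R : realType) (p : R) (N : nat) (rho : R)
    (x : int -> R) (j : nat) :
  0 < p -> 0 < rho -> configurations N rho x ->
  excess p N rho x j.+2 <=
  excess p N rho x j.+1 + (j.+2%:R `^ (1 + p))^-1 * excess p N rho x 1.
Proof.
move=> p0 rho0 cx.
have h : excess p N rho x j.+2 <=
    (j.+1%:R / j.+2%:R) `^ (1 + p) * excess p N rho x j.+1 +
    (j.+2%:R `^ (1 + p))^-1 * excess p N rho x 1.
  rewrite /excess (pair_sumS_equidistant p N j rho0).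
  by have := pair_sumS_le j p0 cx; lra.
apply: le_trans h _; rewrite lerD2r ler_piMl ?excess_ge0//.
rewrite -[X in _ <= X](_ : 1 `^ (1 + p) = 1); last by rewrite powR1.
rewrite ge0_ler_powR ?nnegrE ?divr_ge0 ?ler0n ?(ltW (addr_gt0 ltr01 p0))//.
by rewrite ler_pdivrMr ?ltr0n// mul1r ler_nat.
Qed.

(** The first pair is computed exactly: D_2 carries the factor 2 * 2^(-1-p), which explains the
    [+ 1] beside the series, and the defect of S_2 is kept for strictness. Every later pair costs at
    most (2(M+2))^(-1-p) D_1, which is 2^(-1-p) times the next zeta term. *)
Lemma alternating_excess_ge (R : realType) (p : R) (N : nat) (rho : R)
    (x : int -> R) (M : nat) :
  0 < p -> 0 < rho -> configurations N rho x ->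
  (2 * (2 `^ (1 + p))^-1 * pair_sum p N x 1 - pair_sum p N x 2) +
  (1 - (2 `^ (1 + p))^-1 *
     (series (fun k : nat => (k.+1%:R `^ (1 + p))^-1) M.+1 + 1)) *
  excess p N rho x 1 <=
  \sum_(0 <= j < M.+1.*2) (-1) ^+ j * excess p N rho x j.+1.
Proof.
move=> p0 rho0 cx; elim: M => [|M IH].
  rewrite seriesEnat /= big_nat1 powR1 invr1 doubleS double0.
  rewrite big_nat_recr//= big_nat1 expr0 expr1 mul1r mulN1r.
  by rewrite /excess (pair_sum2_equidistant p N rho0); lra.
rewrite seriesSr doubleS (big_nat_recr M.+1.*2.+1)// (big_nat_recr M.+1.*2)//.
move: IH.
rewrite exprS -signr_odd odd_double expr0 mulr1 mul1r mulN1r.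
have := excessS_le M.+1.*2 p0 rho0 cx.
have -> : M.+1.*2.+2 = (2 * M.+2)%N by lia.
rewrite natrM powRM// invfM.
set s := series _ _; set w := (M.+2%:R `^ _)^-1; set S := \sum_(_ <= _ < _) _.
set E1 := excess _ _ _ _ 1; set E2 := excess _ _ _ _ _; set E3 := excess _ _ _ _ _.
set b := (2 `^ _)^-1; set c := pair_sum _ _ _ 2.
by move=> h1 h2 /=; lra.
Qed.

(** * The energy as a limit of alternating sums *)

(** The species agree exactly when [k - n] is even, so the sign depends only on the index
    distance. *)
Lemma riesz_pair_energy (R : realType) (p : R) (x : int -> R) (n k : int) :
  pair_energy (riesz_potentials p) x n k =
  (-1) ^+ (`|k - n|%N.+1) * `|x k - x n| `^ (- p).
Proof.
rewrite /pair_energy /species_of exprS -signr_odd powRN.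
have -> : odd `|k - n|%N = odd `|n|%N (+) odd `|k|%N by lia.
by case: (odd `|n|%N) (odd `|k|%N) => -[] /=; rewrite ?expr0 ?expr1; ring.
Qed.

Lemma riesz_partial_site_energy (R : realType) (p : R) (N : nat) (rho : R)
    (x : int -> R) (n : int) :
  configurations N rho x ->
  partial_site_energy (riesz_potentials p) x n =
  series (fun j => (-1) ^+ j * ((x (n + j.+1%:Z) - x n) `^ (- p) +
                                (x n - x (n - j.+1%:Z)) `^ (- p))).
Proof.
move=> cx; apply/funext => K; rewrite /partial_site_energy seriesEnat /=.
rewrite big_add1 /=; apply: eq_bigr => j _; rewrite !riesz_pair_energy.
have -> : `|(n + j.+1%:Z - n)%R|%N = j.+1 by lia.
have -> : `|(n - j.+1%:Z - n)%R|%N = j.+1 by lia.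
rewrite gtr0_norm ?subr_gt0 ?(configurations_lt _ cx)//.
rewrite ltr0_norm ?opprB.
  by rewrite !exprS; ring.
have := @configurations_lt _ _ _ _ (n - j.+1%:Z) j.+1 cx isT.
by rewrite subrK subr_lt0.
Qed.

Lemma powRN_small (R : realType) (p L e : R) : 0 < p -> 0 < L -> 0 < e ->
  exists k : nat, (k.+1%:R * L) `^ (- p) < e.
Proof.
move=> p0 L0 e0; pose A := e `^ (- p^-1).
have A0 : 0 < A by rewrite powR_gt0.
have [k hk] : exists k : nat, A / L < k.+1%:R.
  exists (Num.truncn (A / L)); exact: Num.Theory.truncnS_gt.
exists k; have kL : A < k.+1%:R * L by rewrite -ltr_pdivrMr.
have kL0 := lt_trans A0 kL.
have -> : e = A `^ (- p).
  by rewrite /A -powRrM mulrNN mulVf ?gt_eqF// powRr1// ltW.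
rewrite !powRN ltf_pV2 ?posrE ?powR_gt0//.
by rewrite gt0_ltr_powR// nnegrE ltW.
Qed.

(** Leibniz criterion: the terms decrease because distances grow with the index, and they tend to 0
    because the distance over whole periods is an explicit multiple of N / rho. *)
Lemma riesz_site_cvg (R : realType) (p : R) (N : nat) (rho : R) (x : int -> R)
    (n : int) :
  0 < p -> 0 < rho -> (0 < N)%N -> configurations N rho x ->
  cvgn (partial_site_energy (riesz_potentials p) x n).
Proof.
move=> p0 rho0 N0 cx; rewrite (riesz_partial_site_energy p n cx).
pose a j := (x (n + j.+1%:Z) - x n) `^ (- p) + (x n - x (n - j.+1%:Z)) `^ (- p).
rewrite -[series _]/(series (fun j => (-1) ^+ j * a j)).
have fwd m j : 0 < x (m + j.+1%:Z) - x m by rewrite subr_gt0 (configurations_lt _ cx).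
have bwd m j : 0 < x m - x (m - j.+1%:Z).
  by have := fwd (m - j.+1%:Z) j; rewrite subrK.
have age0 j : 0 <= a j by rewrite addr_ge0 ?powR_ge0.
have amono j : a j.+1 <= a j.
  rewrite /a; apply: lerD; rewrite !powRN lef_pV2 ?posrE ?powR_gt0//;
    rewrite ge0_ler_powR ?nnegrE ?(ltW p0) ?(ltW (fwd _ _)) ?(ltW (bwd _ _))//.
    have -> : n + j.+2%:Z = n + j.+1%:Z + 1%:Z by lia.
    by rewrite lerD2r ltW// -subr_gt0 fwd.
  have -> : n - j.+2%:Z = n - j.+1%:Z - 1%:Z by lia.
  by rewrite lerD2l lerN2 ltW// -subr_gt0 bwd.
have aninc i j : (i <= j)%N -> a j <= a i.
  by move=> /subnK <-; elim: (j - i)%N => // m IH; apply: le_trans (amono _) IH.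
apply: cvg_alternating_series => //.
apply/cvgr0Pnorm_lt => e e0.
have L0 : 0 < rho^-1 * N%:R by rewrite mulr_gt0 ?invr_gt0 ?ltr0n.
have [k hk] := powRN_small p0 L0 (divr_gt0 e0 (ltr0n _ 2)).
(* The predecessor appears because [a j] belongs to index distance [j.+1]; each of its two powers is
   below [e / 2]. *)
exists (k.+1 * N).-1 => // j /= kj; rewrite ger0_norm//.
apply: le_lt_trans (aninc _ _ kj) _; rewrite /a prednK ?muln_gt0//.
have -> : x n - x (n - (k.+1 * N)%:Z) = k.+1%:R * (rho^-1 * N%:R).
  by rewrite -[in x n](subrK (k.+1 * N)%:Z n) (configurations_addMn _ _ cx); ring.
by rewrite (configurations_addMn _ _ cx) addrAC subrr add0r; move: hk; lra.
Qed.

(** The backward distances are the forward ones shifted by [- j.+1], whence the factor 2. *)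
Lemma sum_partial_site_energy (R : realType) (p : R) (N : nat) (rho : R)
    (x : int -> R) (K : nat) :
  configurations N rho x ->
  \sum_(1 <= n < N.+1) partial_site_energy (riesz_potentials p) x n%:Z K =
  2 * \sum_(0 <= j < K) (-1) ^+ j * pair_sum p N x j.+1.
Proof.
move=> cx; under eq_bigr do rewrite (riesz_partial_site_energy p _ cx) seriesEnat /=.
rewrite exchange_big /= mulr_sumr; apply: eq_bigr => j _.
rewrite -mulr_sumr mulrCA big_split /=; congr (_ * _).
rewrite mulr_natl mulr2n; congr (_ + _).
rewrite /pair_sum -[RHS](@sum_period_shift _ N
  (fun k => (x (k + j.+1%:Z) - x k) `^ (- p)) (- j.+1%:Z)).
  by apply: eq_bigr => i _; rewrite subrK.
by move=> k; rewrite (configurations_distN _ _ cx).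
Qed.

(** The sites are summed at a common cutoff before the limit, so no conditionally convergent series
    is rearranged. *)
Lemma cvg_energy (R : realType) (p : R) (N : nat) (rho : R) (x : int -> R) :
  0 < p -> 0 < rho -> (0 < N)%N -> configurations N rho x ->
  N%:R^-1 * (2 * \sum_(0 <= j < K) (-1) ^+ j * pair_sum p N x j.+1) @[K --> \oo] -->
  energy (riesz_potentials p) N x.
Proof.
move=> p0 rho0 N0 cx.
under eq_cvg do rewrite -(sum_partial_site_energy p _ cx).
apply: cvgM; first exact: cvg_cst.
apply: cvg_big => [|n _]; first exact: add_continuous.
exact: riesz_site_cvg rho0 N0 cx.
Qed.

(** * Energy comparison and uniqueness *)

(** The condition on zeta makes the D_1 term nonnegative, so it is discarded; the defect of S_2
    survives the limit and later decides uniqueness. *)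
Lemma energy_excess_ge (R : realType) (p : R) (N : nat) (rho : R) (x : int -> R) :
  0 < p -> 0 < rho -> (0 < N)%N -> configurations N rho x ->
  zeta (1 + p) + 1 <= 2 `^ (1 + p) ->
  energy (riesz_potentials p) N (equidistant rho) +
  N%:R^-1 * (2 * (2 * (2 `^ (1 + p))^-1 * pair_sum p N x 1 - pair_sum p N x 2)) <=
  energy (riesz_potentials p) N x.
Proof.
move=> p0 rho0 N0 cx zp; rewrite -lerBrDl.
have c : N%:R^-1 * (2 * \sum_(0 <= j < K) (-1) ^+ j * excess p N rho x j.+1)
    @[K --> \oo] --> energy (riesz_potentials p) N x -
    energy (riesz_potentials p) N (equidistant rho).
  apply: cvg_trans (cvgB (cvg_energy p0 rho0 N0 cx)
    (cvg_energy p0 rho0 N0 (equidistant_configurations N rho0))).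
  apply: near_eq_cvg; apply: nearW => K; rewrite -[LHS]mulrBr -mulrBr -sumrB.
  by congr (_ * (_ * _)); apply: eq_bigr => j _; rewrite -mulrBr.
(* Even cutoffs suffice for the limit and group each repulsive term with the next attractive one. *)
have dbl : (fun M => M.+1.*2) @ \oo --> \oo.
  move=> A [n _ nA]; exists n => // m /= nm; apply: nA => /=; lia.
have {dbl}c := cvg_comp _ _ dbl c.
rewrite -(cvg_lim _ c)//; apply: limr_ge; first by apply/cvg_ex; eexists; exact: c.
apply: nearW => M /=.
rewrite ler_pM2l ?invr_gt0 ?ltr0n// ler_pM2l//.
apply: le_trans (alternating_excess_ge M p0 rho0 cx).
rewrite lerDl mulr_ge0 ?excess_ge0// subr_ge0 mulrC ler_pdivrMr ?powR_gt0// mul1r.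
by apply: le_trans zp; rewrite lerD2r zeta_ge_series.
Qed.

Lemma equal_gaps_equidistant (R : realType) (N : nat) (rho : R) (x : int -> R) :
  0 < rho -> (0 < N)%N -> configurations N rho x ->
  (forall n : nat, (1 <= n < N.+1)%N ->
     x (n%:Z + 1) - x n%:Z = x (n%:Z + 2) - x (n%:Z + 1)) ->
  x = equidistant rho.
Proof.
move=> rho0 N0 cx hg; have [x0 _ xN] := cx.
(* The absolute second difference is periodic with zero sum over a period, so it vanishes at every
   integer. *)
pose f k := `|x (k + 2) - x (k + 1) - (x (k + 1) - x k)|.
have fN k : f (k + N%:Z) = f k.
  by rewrite /f !(addrAC k N%:Z) !xN; congr `|_|; ring.
have f0 k : f k = 0.
  have : \sum_(1 <= n < N.+1) f (n%:Z + (k - 1)) = 0.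
    (* Shifting by [k - 1] makes [f k] the first summand of a vanishing sum of nonnegative terms. *)
    rewrite (sum_period_shift _ fN) big_nat big1// => n nN.
    by rewrite /f hg// subrr normr0.
  rewrite big_nat_recl// => /eqP; rewrite addr_eq0.
  have -> : 1%:Z + (k - 1) = k by ring.
  move=> /eqP fk; apply/eqP; rewrite eq_le normr_ge0 andbT.
  by rewrite -/(f k) fk oppr_le0 sumr_ge0// => i _; exact: normr_ge0.
pose g := x 1.
have gS k : x (k + 2) - x (k + 1) = x (k + 1) - x k.
  by apply/eqP; rewrite -subr_eq0 -normr_eq0; apply/eqP; exact: f0.
have xlin : forall k, x (k + 1) - x k = g /\ x k = k%:~R * g.
  apply: (@int_rec (fun k => x (k + 1) - x k = g /\ x k = k%:~R * g)).
  - by rewrite add0r x0 subr0 mul0r.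
  - move=> k [h1 h2]; have e : k.+1%:Z = k%:Z + 1 by lia.
    have e2 : k.+1%:Z + 1 = k%:Z + 2 by lia.
    by rewrite e2 e gS h1; split=> //; rewrite intrD mulrDl -h2 mul1r -h1; ring.
  - move=> k [h1 h2]; have := gS (- k.+1%:Z).
    have -> : - k.+1%:Z + 2 = - k%:Z + 1 by lia.
    have e : - k.+1%:Z + 1 = - k%:Z by lia.
    rewrite e h1 => h3; split=> //.
    have -> : x (- k.+1%:Z) = x (- k%:Z) - g by rewrite h3; ring.
    by rewrite h2 -e intrD; ring.
(* The common gap is fixed by the length of one period. *)
have gE : g = rho^-1.
  have := xN 0; rewrite add0r x0 add0r (xlin N%:Z).2 -pmulrn mulrC.
  by apply: mulIf; rewrite pnatr_eq0 -lt0n.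
by apply/funext => k; rewrite (xlin k).2 gE.
Qed.

Theorem theorem2p4 (R : realType) :
  exists p0 : R,
    unique (fun q : R => 0 < q /\ zeta (1 + q) + 1 = 2 `^ (1 + q)) p0 /\
    forall p : R, p0 <= p ->
    forall (rho : R) (N : nat), 0 < rho -> (0 < N)%N -> ~~ odd N ->
      (forall x : int -> R, configurations N rho x ->
         forall n : int,
           cvgn (partial_site_energy (riesz_potentials p) x n)) /\
      unique_minimizer (energy (riesz_potentials p) N)
        (configurations N rho) (equidistant rho).
Proof.
have [p0 p0P] := zeta_threshold R; exists p0; split=> //.
move: p0P => [[p0gt0 zp0] _] p p0p rho N rho0 N0 _.
have pgt0 : 0 < p by exact: lt_le_trans p0p.
split=> [x cx n|]; first exact: riesz_site_cvg rho0 N0 cx.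
(* The equality at [p0] becomes an inequality beyond it, by opposite monotonicity of the two
   sides. *)
have zp : zeta (1 + p) + 1 <= 2 `^ (1 + p).
  apply: (@le_trans _ _ (zeta (1 + p0) + 1)); first by rewrite lerD2r zeta_nonincreasing.
  by rewrite zp0 ler_powR ?ler1n// lerD2l.
have ce := equidistant_configurations N rho0.
have NV0 : 0 < N%:R^-1 :> R by rewrite invr_gt0 ltr0n.
split.
  split=> // y cy; apply: le_trans (energy_excess_ge pgt0 rho0 N0 cy zp).
  by rewrite lerDl pmulr_rge0// pmulr_rge0// subr_ge0 (pair_sum2_le pgt0 cy).
move=> x [cx xmin]; apply/esym/(equal_gaps_equidistant rho0 N0 cx) => n nN.
(* Two unequal consecutive gaps would make the defect of S_2 positive and the energy larger than the
   equidistant one. *)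
apply/eqP/negPn/negP => ne.
have := xmin _ ce; rewrite leNgt => /negP; apply.
apply: lt_le_trans (energy_excess_ge pgt0 rho0 N0 cx zp).
rewrite ltrDl pmulr_rgt0// pmulr_rgt0// subr_gt0; apply: (pair_sum2_lt pgt0 cx).
by exists n.
Qed.
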